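(* If $U\in\mathcal G_k\mathcal P_n$ admits a basis of top powers, then $W(U)$ is an $\ell$th power, with $$W(U)=W\big(U^{(\ell-1)}\big)^{\ell},$$ where the equality is relative to $\mathcal G_1\mathcal P_{k\ell}$, i.e. up to a nonzero scalar multiple.
   Context: Work over $\mathbb C$. Here $n\ge0$, $1\le k\le n+1$ and $\ell=n+1-k$. $\mathcal P_n$ is the vector space of polynomials in $z$ of degree $\le n$; $\mathcal G_k\mathcal P_n$ is the Grassmannian of $k$-dimensional subspaces of $\mathcal P_n$. A top power in $\mathcal P_n$ is a polynomial of the form $(az+b)^n$ with $(a,b)\neq(0,0)$. For $j\ge0$, $U^{(j)}$ denotes the subspace spanned by the $j$th derivatives of the elements of $U$. For a finite-dimensional polynomial subspace $V$ with basis $p_1,\dots,p_r$, $W(V)$ is the Wronskian $\det(p_i^{(j-1)})_{1\le i,j\le r}$, a polynomial defined up to a nonzero scalar multiple; for $U\in\mathcal G_k\mathcal P_n$ it has degree $\le k\ell$ and $W(U)$ is regarded as an element of $\mathcal G_1\mathcal P_{k\ell}$.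
   Formalization: The equality with U^{(l-1)} is false if U contains constants, k≥2, l≥2 (e.g. U=<1,z^3>, n=3), so it is stated outside that case; for all U, W(U) is an lth power and the equality holds with order l-1 partial derivatives of binary forms; for l=0, U^{(-1)} is read as U. *)

(* Defs.v *)
From HB Require Import structures.
From mathcomp Require Import all_boot all_order all_algebra.

Set Implicit Arguments.
Unset Strict Implicit.
Unset Printing Implicit Defensive.

Import GRing.Theory.
Local Open Scope ring_scope.

(* The space of polynomials of degree <= n is the vectType {poly_(n.+1) F}:   *)
(* the index of the library type bounds the size, which is the degree plus 1. *)

Definition top_power (F : fieldType) (n : nat) (p : {poly F}) : Prop :=
  exists a b : F, (a, b) != (0, 0) /\ p = (a *: 'X + b%:P) ^+ n.

Definition has_top_power_basis (F : fieldType) (n k : nat)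
    (U : {vspace {poly_(n.+1) F}}) : Prop :=
  exists X : k.-tuple {poly_(n.+1) F},
    basis_of U X /\ forall i : 'I_k, top_power n (tnth X i : {poly F}).

Definition wronskian (F : fieldType) (r : nat) (p : 'I_r -> {poly F}) :
    {poly F} :=
  \det (\matrix_(i < r, j < r) (p i)^`(j)).

(* The Wronskian of a space is only meant up to a nonzero scalar, that is, up *)
(* to %=; Wronskian_basis shows that the choice of basis is then immaterial.  *)
(* The zero space has Wronskian 1 (empty determinant).                        *)
Definition Wronskian (F : fieldType) (m : nat) (V : {vspace {poly_m F}}) :
    {poly F} :=
  wronskian (fun i : 'I_(\dim V) => (vbasis V)`_i : {poly F}).

Definition npoly_derivn (F : fieldType) (m j : nat) (p : {poly_m F}) :
    {poly_m F} :=
  npolyp m ((p : {poly F})^`(j)).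

(* The space of j-th derivatives d^j p / dz^j, p in U; it is kept inside      *)
(* {poly_m F}, which does not affect its Wronskian.                           *)
Definition derived_space (F : fieldType) (m j : nat)
    (U : {vspace {poly_m F}}) : {vspace {poly_m F}} :=
  (linfun (npoly_derivn j) @: U)%VS.

(* The constants are top powers ((a, b) = (0, b)): their root is at infinity, *)
(* and d/dz kills them, so a space with a basis of top powers can lose        *)
(* dimension in derived_space. E.g. U = <1, z^3> in degree <= 3, k = l = 2,   *)
(* has W(U) = 3 z^2 but W(<z^2>)^2 = z^4. The derivatives of the associated   *)
(* binary forms, below, treat all points of the projective line alike; when   *)
(* U has a basis of top powers of which none is constant, both definitions    *)
(* give the same space at order l - 1.                                        *)

(* Identify p, of degree <= d, with the binary form P(z, w) = w^d p(z / w).   *)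
(* The partial derivatives of P, which are forms of degree d - 1, correspond  *)
(* to p' (along z) and, by Euler's identity, to d p - z p' (along w).         *)
Definition form_dw (F : fieldType) (m d : nat) (p : {poly_m F}) : {poly_m F} :=
  npolyp m ((p : {poly F}) *+ d - 'X * (p : {poly F})^`()).

(* The span of all partial derivatives of order j of the binary forms of      *)
(* degree d in U; after j derivations the degree of the forms is d - j.       *)
Fixpoint form_derived_space (F : fieldType) (m d j : nat)
    (U : {vspace {poly_m F}}) : {vspace {poly_m F}} :=
  if j is j'.+1 then
    let V := form_derived_space d j' U in
    (linfun (@npoly_derivn F m 1) @: V + linfun (@form_dw F m (d - j')) @: V)%VS
  else U.

(* linfun f agrees with f only for linear f, and npolyp truncates polynomials *)
(* of size > m; the next two lemmas show that neither proviso matters here.   *)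
Lemma npoly_derivnE (F : fieldType) (m j : nat) (p : {poly_m F}) :
  linfun (@npoly_derivn F m j) p = (p : {poly F})^`(j) :> {poly F}.
Proof.
have lin : linear (@npoly_derivn F m j).
  move=> a u v; apply/npolyP=> i; rewrite !coef_npolyp /=.
  rewrite coefD coefZ !coef_npolyp linearP coefD coefZ.
  by case: ifP; rewrite ?mulr0 ?addr0.
pose f : {linear {poly_m F} -> {poly_m F}} :=
  HB.pack (@npoly_derivn F m j) (GRing.isLinear.Build _ _ _ _ _ lin).
rewrite (lfunE f) /= /npoly_derivn npolypK //.
elim: j {lin f} => [|j IH]; first by rewrite derivn0.
by rewrite derivnS (leq_trans (size_poly _ _)) // (leq_trans (leq_pred _)).
Qed.

Lemma form_dwE (F : fieldType) (m d : nat) (p : {poly_m F}) :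
  linfun (@form_dw F m d) p
    = (p : {poly F}) *+ d - 'X * (p : {poly F})^`() :> {poly F}.
Proof.
have lin : linear (@form_dw F m d).
  move=> a u v; apply/npolyP=> i; rewrite /form_dw coef_npolyp /=.
  rewrite [RHS]coefD coefZ !coef_npolyp; case: ifP => _; last first.
    by rewrite mulr0 addr0.
  rewrite linearP !coefB !coefMn mulrDr coefD -scalerAr !coefZ coefD coefZ.
  by rewrite mulrBr mulrnDl mulrnAr opprD addrACA.
pose f : {linear {poly_m F} -> {poly_m F}} :=
  HB.pack (@form_dw F m d) (GRing.isLinear.Build _ _ _ _ _ lin).
rewrite (lfunE f) /= /form_dw npolypK //; apply/leq_sizeP=> i lemi.
rewrite coefB coefMn coefXM coef_deriv (big_coef_npoly p lemi) mul0rn sub0r.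
by case: i lemi => [|i] lemi; rewrite ?oppr0 //= big_coef_npoly // mul0rn oppr0.
Qed.

Lemma Wronskian_basis (F : fieldType) (m r : nat) (V : {vspace {poly_m F}})
    (X : r.-tuple {poly_m F}) :
  basis_of V X -> wronskian (fun i => tnth X i : {poly F}) %= Wronskian V.
Proof.
move=> bX; have rV : r = \dim V by rewrite -(size_basis bX).
move: X bX; rewrite rV => X bX; rewrite /Wronskian /wronskian.
have bY := vbasisP V; set Y := vbasis V in bY *.
pose M (Z : (\dim V).-tuple {poly_m F}) :=
  \matrix_(i < \dim V, j < \dim V) ((tnth Z i : {poly F})^`(j)).
have dvM (Z T : (\dim V).-tuple {poly_m F}) :
    basis_of V Z -> basis_of V T -> \det (M T) %| \det (M Z).
  move=> bZ bT.
  suff -> : M Z = map_mx polyC (\matrix_(i, l) coord T l (tnth Z i)) *m M T.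
    by rewrite det_mulmx dvdp_mull.
  apply/matrixP=> i j; rewrite !mxE.
  have ZV : tnth Z i \in V by exact: (basis_mem bZ (mem_tnth i Z)).
  rewrite {1}(coord_basis bT ZV) raddf_sum /= linear_sum /=.
  by apply: eq_bigr => l _; rewrite !mxE [in LHS]linearZ /= mul_polyC (tnth_nth 0 T).
have -> : \matrix_(i < \dim V, j < \dim V) ((Y`_i : {poly F})^`(j)) = M Y.
  by apply/matrixP=> i j; rewrite !mxE (tnth_nth 0).
by rewrite /eqp !dvM.
Qed.

(* Main.v *)
Require Import Defs.
From HB Require Import structures.
From mathcomp Require Import all_boot all_order all_algebra.
From mathcomp Require Import zify ring reals.
From mathcomp.real_closed Require Import complex.

Set Implicit Arguments.
Unset Strict Implicit.
Unset Printing Implicit Defensive.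

Import Order.TTheory GRing.Theory Num.Theory.
Local Open Scope ring_scope.

(** Let U have a basis of n-th powers of the linear polynomials
    L_i = a_i z + b_i, i < k, and let l = n + 1 - k.  The j-th derivative of
    L_i ^ n is a constant depending on j only, times a_i ^ j L_i ^ (n - j), and
    n - j = l + (k - 1 - j).  Hence L_i ^ l can be taken out of row i of the
    Wronskian matrix, and what is left is the homogeneous Vandermonde matrix
    (a_i ^ j L_i ^ (k - 1 - j)), whose determinant is the product over i < j of
    L_i a_j - a_i L_j = b_i a_j - a_i b_j: the variable z cancels
    ([wronskian_linpoly_exp]).  These numbers are nonzero, because two
    proportional L_i would have proportional powers.  So W(U) is
    (\prod_i L_i) ^ l up to a nonzero scalar.

    Suppose l > 0, both sides being constants when l = 0.
    An order l - 1 derivative turns each line <L_i ^ n> into <L_i ^ k>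
    ([derived_linpower_span], [form_derived_linpower_span]), and the same
    computation with n replaced by k gives exponent k + 1 - k = 1: the
    Wronskian of the derived space is \prod_i L_i, which is the l-th root of
    W(U) sought.  The only obstruction, when l > 1, is a basis element killed by
    the derivation.  Differentiating along both variables of the associated forms
    never kills one, since a_i and b_i do not both vanish; d/dz kills exactly
    the constant L_i, and then 1 lies in U.  When k = 1 a constant is harmless,
    both Wronskians being constant. *)

(** * The homogeneous Vandermonde determinant *)

(** Each index belongs to k - 1 unordered pairs; this is the homogenizing factor
    between the affine and the homogeneous Vandermonde determinants. *)
Lemma prod_lt_pairs_mul (R : comRingType) (k : nat) (b : 'I_k -> R) :
  \prod_(i < k) \prod_(j < k | (i < j)%N) (b i * b j)
    = \prod_(i < k) b i ^+ k.-1.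
Proof.
under eq_bigr => i _ do rewrite big_split /=.
rewrite big_split /= [X in _ * X](exchange_big_dep predT) //= -big_split /=.
apply: eq_bigr => i _.
have -> : b i ^+ k.-1 = \prod_(j < k | j != i) b i.
  by rewrite prodr_const cardC1 card_ord.
rewrite [RHS](bigID (fun j : 'I_k => (i < j)%N)) /=.
by congr (_ * _); apply: eq_bigl => j; rewrite -val_eqE /=; case: ltngtP.
Qed.

(** Dividing row i by b_i ^ (k - 1) leaves the Vandermonde matrix of the
    a_i / b_i. *)
Lemma det_hom_Vandermonde_field (F : fieldType) (k : nat) (a b : 'I_k -> F) :
  (forall i, b i != 0) ->
  \det (\matrix_(i < k, j < k) (a i ^+ j * b i ^+ (k - j.+1)))
    = \prod_(i < k) \prod_(j < k | (i < j)%N) (b i * a j - a i * b j).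
Proof.
move=> b0.
pose D := diag_mx (\row_(i < k) b i ^+ k.-1).
pose V := Vandermonde k (\row_(i < k) (a i / b i)).
have -> : \matrix_(i < k, j < k) (a i ^+ j * b i ^+ (k - j.+1)) = D *m V^T.
  apply/matrixP=> i j; rewrite mul_diag_mx !mxE expr_div_n.
  have -> : k.-1 = (k - j.+1 + j)%N by have := ltn_ord j; lia.
  by rewrite exprD mulrACA divff ?expf_neq0 // mulr1 mulrC.
rewrite det_mulmx det_diag det_tr det_Vandermonde.
under eq_bigr => i _ do rewrite mxE.
rewrite -prod_lt_pairs_mul -big_split /=; apply: eq_bigr => i _.
rewrite -big_split /=; apply: eq_bigr => j _; rewrite !mxE.
rewrite mulrBr; congr (_ - _).
  by rewrite -mulrA [b j * _]mulrC divfK.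
by rewrite mulrAC [b i * _]mulrC divfK.
Qed.

(** The field case, read in the field of fractions; it will be applied over the
    ring of polynomials, with linear polynomials as the b_i. *)
Lemma det_hom_Vandermonde (D : idomainType) (k : nat) (a b : 'I_k -> D) :
  (forall i, b i != 0) ->
  \det (\matrix_(i < k, j < k) (a i ^+ j * b i ^+ (k - j.+1)))
    = \prod_(i < k) \prod_(j < k | (i < j)%N) (b i * a j - a i * b j).
Proof.
move=> b0; apply/eqP; rewrite -tofrac_eq -det_map_mx rmorph_prod; apply/eqP.
have b0' i : tofrac (b i) != 0 by rewrite tofrac_eq0.
transitivity (\det (\matrix_(i < k, j < k)
    (tofrac (a i) ^+ j * tofrac (b i) ^+ (k - j.+1)))).
  by congr (\det _); apply/matrixP=> i j; rewrite !mxE rmorphM !rmorphXn.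
rewrite det_hom_Vandermonde_field //; apply: eq_bigr => i _.
by rewrite rmorph_prod; apply: eq_bigr => j _; rewrite rmorphB !rmorphM.
Qed.

(** * Powers of linear polynomials and their Wronskians *)

Definition linpoly (R : nzRingType) (a b : R) : {poly R} := a *: 'X + b%:P.

Section PowersOfLinearPolynomials.
Variable F : fieldType.
Implicit Types (a b c : F) (m n d j k : nat).

Lemma size_linpoly a b : (size (linpoly a b) <= 2)%N.
Proof.
rewrite /linpoly (leq_trans (size_polyD _ _)) // geq_max.
rewrite (leq_trans (size_scale_leq _ _)) ?size_polyX //=.
by rewrite (leq_trans (size_polyC_leq1 _)).
Qed.

Lemma linpoly_eq0 a b : (linpoly a b == 0) = ((a, b) == (0, 0)).
Proof.
apply/eqP/eqP=> [/polyP L0|[-> ->]]; last by rewrite /linpoly scale0r addr0.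
move: (L0 1%N) (L0 0%N).
by rewrite !coefD !coefZ !coefX !coefC /= !mulr1 !mulr0 addr0 add0r => -> ->.
Qed.

Lemma deriv_linpoly a b : (linpoly a b)^`() = a%:P.
Proof. by rewrite derivD derivZ derivX derivC addr0 alg_polyC. Qed.

Lemma derivn_linpoly_exp a b m j :
  (linpoly a b ^+ m)^`(j) = (a ^+ j *+ m ^_ j) *: linpoly a b ^+ (m - j).
Proof.
elim: j => [|j IH]; first by rewrite derivn0 subn0 scale1r.
rewrite derivnS IH derivZ deriv_exp deriv_linpoly mul_polyC subnS.
rewrite -scaler_nat !scalerA ffactnSr; congr (_ *: _).
by rewrite -[RHS]mulr_natr natrM exprSr -mulr_natr; ring.
Qed.

(** The Wronskian matrix is a homogeneous Vandermonde matrix in the a_i and the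
    L_i, with row i multiplied by L_i ^ (m + 1 - k) and column j by the falling
    factorial of m; in L_i a_j - a_i L_j the terms in z cancel. *)
Lemma wronskian_linpoly_exp m k (a b : 'I_k -> F) :
    (k <= m.+1)%N -> (forall i, (a i, b i) != (0, 0)) ->
  wronskian (fun i => linpoly (a i) (b i) ^+ m)
    = ((\prod_(j < k) (m ^_ j)%:R)
        * \prod_(i < k) \prod_(j < k | (i < j)%N) (b i * a j - a i * b j))
      *: (\prod_(i < k) linpoly (a i) (b i)) ^+ (m.+1 - k).
Proof.
move=> lekm ab0; pose L i := linpoly (a i) (b i).
pose D := diag_mx (\row_(i < k) L i ^+ (m.+1 - k)).
pose H := \matrix_(i < k, j < k) ((a i)%:P ^+ j * L i ^+ (k - j.+1)).
pose E := diag_mx (\row_(j < k) ((m ^_ j)%:R : {poly F})).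
have -> : wronskian (fun i => L i ^+ m) = \det (D *m H *m E).
  congr (\det _); apply/matrixP=> i j.
  rewrite mul_mx_diag mul_diag_mx !mxE derivn_linpoly_exp.
  have -> : (m - j = m.+1 - k + (k - j.+1))%N.
    by rewrite addnBA // subnK // subSS.
  rewrite exprD -mul_polyC polyCMn rmorphXn /= mulrCA mulr_natr.
  by rewrite mulrnAl mulrnAr.
rewrite !det_mulmx !det_diag det_hom_Vandermonde; last first.
  by move=> i; rewrite linpoly_eq0.
under eq_bigr => i _ do rewrite mxE.
under [X in _ * _ * X = _]eq_bigr => i _ do rewrite mxE.
rewrite -prodrXl -mulrA mulrC -mul_polyC; congr (_ * _).
rewrite mulrC polyCM !rmorph_prod; congr (_ * _).
  by apply: eq_bigr => j _; rewrite rmorph_nat.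
apply: eq_bigr => i _; rewrite rmorph_prod; apply: eq_bigr => j _.
by rewrite rmorphB !rmorphM /= /L /linpoly -!mul_polyC; ring.
Qed.

(** * Wronskians and lines in spaces of polynomials *)

Lemma vline_scale (vT : vectType F) c (v : vT) :
  c != 0 -> (<[c *: v]> = <[v]>)%VS.
Proof.
move=> c0; apply/eqP; rewrite eqEsubv -!memvE memvZ ?memv_line //=.
by rewrite -[v in v \in _](scalerK c0) memvZ ?memv_line.
Qed.

(** A linear relation between polynomials holds between their derivatives, hence
    between the rows of the Wronskian matrix. *)
Lemma free_of_wronskian m k (X : k.-tuple {poly_m F}) :
  wronskian (fun i => tnth X i : {poly F}) != 0 -> free X.
Proof.
move=> W0; apply/freeP=> c Xc0 i; apply/eqP.
apply: contraNT W0 => ci0; apply/det0P.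
exists (\row_j (c j)%:P).
  by apply: contraNneq ci0 => /rowP/(_ i)/eqP; rewrite !mxE polyC_eq0.
apply/rowP=> j; rewrite !mxE.
transitivity ((\sum_(i < k) c i *: X`_i : {poly_m F}) : {poly F})^`(j).
  rewrite !raddf_sum /=; apply: eq_bigr => l _.
  by rewrite !mxE [in RHS]linearZ /= mul_polyC (tnth_nth 0).
by rewrite Xc0 linear0.
Qed.

Lemma Wronskian0 m : Wronskian (0 : {vspace {poly_m F}})%VS %= 1.
Proof.
have /Wronskian_basis : basis_of (0 : {vspace {poly_m F}})%VS (nil_tuple _).
  exact: nil_basis.
by rewrite /wronskian det_mx00 eqp_sym.
Qed.

(** * Spans of powers of linear polynomials *)

Definition linpower m d a b : {poly_m F} := npolyp m (linpoly a b ^+ d).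

Lemma linpowerE m d a b :
  (d < m)%N -> linpower m d a b = linpoly a b ^+ d :> {poly F}.
Proof.
move=> ltdm; rewrite /linpower npolypK //.
rewrite (leq_trans (size_poly_exp_leq _ _)) // (leq_trans _ ltdm) // ltnS.
by rewrite -[leqRHS]mul1n leq_mul2r -subn1 leq_subLR size_linpoly orbT.
Qed.

Lemma npoly_derivn_linpower m d j a b : (d < m)%N ->
  linfun (@npoly_derivn F m j) (linpower m d a b)
    = (a ^+ j *+ d ^_ j) *: linpower m (d - j) a b.
Proof.
move=> ltdm; apply/val_inj; rewrite /= npoly_derivnE linpowerE //.
by rewrite derivn_linpoly_exp linpowerE // (leq_ltn_trans (leq_subr _ _)).
Qed.

(** Derivation along w, in the affine chart w = 1: d L ^ d - z (L ^ d)' is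
    d L ^ (d - 1) (L - a z) = d b L ^ (d - 1). *)
Lemma form_dw_linpower m d a b : (d < m)%N ->
  linfun (@form_dw F m d) (linpower m d a b)
    = (b *+ d) *: linpower m d.-1 a b.
Proof.
move=> ltdm; apply/val_inj; rewrite /= form_dwE !linpowerE //; last first.
  by rewrite (leq_ltn_trans (leq_pred _)).
case: d ltdm => [|d] _; first by rewrite deriv_exp !mulr0n mulr0 subr0 scale0r.
rewrite deriv_exp deriv_linpoly /= mulrnAr -mulrnBl -scalerMnl; congr (_ *+ _).
rewrite mulrA exprS -mulrBl -mul_polyC; congr (_ * _).
by rewrite /linpoly -mul_polyC; ring.
Qed.

(** A sum of lines rather than the span of a tuple, so that images under linear
    maps are computed line by line, up to a nonzero scalar on each. *)
Definition linpower_span m d k (a b : 'I_k -> F) : {vspace {poly_m F}} :=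
  (\sum_(i < k) <[linpower m d (a i) (b i)]>)%VS.

Lemma linpower_spanE m d k (a b : 'I_k -> F) :
  linpower_span m d a b = <<[tuple linpower m d (a i) (b i) | i < k]>>%VS.
Proof.
by rewrite span_def big_tuple; apply: eq_bigr => i _; rewrite tnth_mktuple.
Qed.

Lemma linpower_proportional m d a b a' b' :
    (a', b') != (0, 0) -> b * a' - a * b' = 0 ->
  exists c, linpower m d a b = c *: linpower m d a' b'.
Proof.
move=> ab0 /eqP; rewrite subr_eq0 => /eqP det0.
suff [c [-> ->]] : exists c, a = c * a' /\ b = c * b'.
  exists (c ^+ d); apply/npolyP=> i; rewrite /linpower.
  have -> : linpoly (c * a') (c * b') = c *: linpoly a' b'.
    by rewrite /linpoly scalerDr scalerA polyCM mul_polyC.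
  rewrite coef_npolyp exprZn coefZ /= !coefZ coef_npolyp.
  by case: ifP; rewrite ?mulr0.
move: ab0; rewrite xpair_eqE negb_and => /orP[a0|b0].
  by exists (a / a'); rewrite divfK // mulrAC -det0 mulfK.
by exists (b / b'); rewrite divfK // mulrAC det0 mulfK.
Qed.

(** Distinct elements of a basis of powers have non-proportional linear
    polynomials, so the factors of the Vandermonde determinant are nonzero. *)
Lemma free_linpower_det m d k (a b : 'I_k -> F) :
    (forall i, (a i, b i) != (0, 0)) ->
    free [tuple linpower m d (a i) (b i) | i < k] ->
  forall i j : 'I_k, i != j -> b i * a j - a i * b j != 0.
Proof.
set X := [tuple _ | i < k]; move=> ab0 /freeP fX i j neij.
apply/negP=> /eqP det0.
have [c eij] := linpower_proportional m d (ab0 j) det0.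
have /fX/(_ i)/eqP : \sum_(l < k) ((l == i)%:R - c *+ (l == j)) *: X`_l = 0.
  have eX (l : 'I_k) : X`_l = linpower m d (a l) (b l).
    by rewrite -tnth_nth tnth_mktuple.
  have neji : j != i by rewrite eq_sym.
  rewrite (bigD1 i) //= (bigD1 j) //= big1 => [|l /andP[li lj]].
    rewrite !eqxx (negPf neij) (negPf neji) !eX.
    by rewrite eij subr0 scale1r sub0r addr0 scaleNr subrr.
  by rewrite (negPf li) (negPf lj) subr0 scale0r.
by rewrite eqxx (negPf neij) subr0 oner_eq0.
Qed.

Lemma top_power_basis_linpower_span n k (U : {vspace {poly_(n.+1) F}}) :
    has_top_power_basis k U ->
  exists a b : 'I_k -> F,
    [/\ forall i, (a i, b i) != (0, 0),
        forall i j : 'I_k, i != j -> b i * a j - a i * b j != 0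
      & U = linpower_span n.+1 n a b].
Proof.
case=> X [bX /fin_all_exists[a /fin_all_exists[b abP]]].
have ab0 i : (a i, b i) != (0, 0) by case: (abP i).
have eX : X = [tuple linpower n.+1 n (a i) (b i) | i < k].
  apply/eq_from_tnth=> i; rewrite tnth_mktuple; apply/val_inj.
  by rewrite /= linpowerE //; case: (abP i).
exists a, b; split=> //; last by rewrite linpower_spanE -eX (span_basis bX).
by apply: (@free_linpower_det n.+1 n) => //; rewrite -eX (basis_free bX).
Qed.

(** * Derived spaces in characteristic zero *)

Hypothesis charF0 : [pchar F] =i pred0.

Lemma ffact_neq0 m j : (j <= m)%N -> (m ^_ j)%:R != 0 :> F.
Proof. by move=> lejm; rewrite ((pcharf0P _).1 charF0) -lt0n ffact_gt0. Qed.

(** The Wronskian of the L_i ^ d is explicit and nonzero, so they form a basis of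
    their span, and this Wronskian is that of the span. *)
Lemma Wronskian_linpower_span m d k (a b : 'I_k -> F) :
    (k <= d.+1)%N -> (d < m)%N -> (forall i, (a i, b i) != (0, 0)) ->
    (forall i j : 'I_k, i != j -> b i * a j - a i * b j != 0) ->
  Wronskian (linpower_span m d a b)
    %= (\prod_(i < k) linpoly (a i) (b i)) ^+ (d.+1 - k).
Proof.
move=> lekd ltdm ab0 abD; set W := _ ^+ _.
pose X := [tuple linpower m d (a i) (b i) | i < k].
have eW : wronskian (fun i => tnth X i : {poly F}) %= W.
  have -> : wronskian (fun i => tnth X i : {poly F})
      = wronskian (fun i => linpoly (a i) (b i) ^+ d).
    congr (\det _); apply/matrixP=> i j.
    by rewrite !mxE tnth_mktuple linpowerE.
  rewrite wronskian_linpoly_exp //; apply: eqp_scale.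
  rewrite mulf_neq0 //; apply/prodf_neq0=> i _.
    by rewrite ffact_neq0 // -ltnS (leq_trans (ltn_ord i)).
  by apply/prodf_neq0=> j ltij; rewrite abD // -val_eqE neq_ltn ltij.
have W0 : W != 0.
  by apply/expf_neq0/prodf_neq0=> i _; rewrite linpoly_eq0.
rewrite (eqp_trans _ eW) // eqp_sym; apply: Wronskian_basis.
rewrite basisEfree linpower_spanE subvv dim_span /= andbT.
apply: (@free_of_wronskian _ _ X); apply: contraNneq W0 => W0.
by move: eW; rewrite W0 eqp_sym eqp0.
Qed.

(** The j-th derivative multiplies the line of L_i ^ d by a_i ^ j: a constant,
    with a_i = 0, survives only when j = 0. *)
Lemma derived_linpower_span m d j k (a b : 'I_k -> F) :
    (d < m)%N -> (j <= d)%N -> (forall i, a i ^+ j != 0) ->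
  derived_space j (linpower_span m d a b) = linpower_span m (d - j) a b.
Proof.
move=> ltdm lejd aj0; rewrite /derived_space limg_sum; apply: eq_bigr => i _.
rewrite limg_line npoly_derivn_linpower // vline_scale //.
by rewrite -mulr_natr mulf_neq0 ?ffact_neq0.
Qed.

(** The two partial derivatives of L_i ^ d are d a_i and d b_i times
    L_i ^ (d - 1), and one of a_i, b_i is nonzero. *)
Lemma form_derived_linpower_span m d j k (a b : 'I_k -> F) :
    (d < m)%N -> (j <= d)%N -> (forall i, (a i, b i) != (0, 0)) ->
  form_derived_space d j (linpower_span m d a b)
    = linpower_span m (d - j) a b.
Proof.
move=> ltdm + ab0; elim: j => [|j IH] ltjd /=; first by rewrite subn0.
rewrite IH 1?ltnW // !limg_sum -big_split /=; apply: eq_bigr => i _.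
have ltdjm : (d - j < m)%N by rewrite (leq_ltn_trans (leq_subr _ _)).
rewrite !limg_line npoly_derivn_linpower // form_dw_linpower // subn1 -subnS.
set v := linpower _ _ _ _; rewrite expr1 ffactn1.
have dj0 : (d - j)%:R != 0 :> F.
  by rewrite ((pcharf0P _).1 charF0) subn_eq0 -ltnNge.
have dj_neq0 c : c != 0 -> c *+ (d - j) != 0.
  by move=> c0; rewrite -mulr_natr mulf_neq0.
have scale_sub c : (<[c *: v]> <= <[v]>)%VS by rewrite -memvE memvZ ?memv_line.
apply/eqP; rewrite eqEsubv subv_add !scale_sub /=.
move: (ab0 i); rewrite xpair_eqE negb_and => /orP[ai0|bi0].
  by rewrite -(vline_scale v (dj_neq0 _ ai0)) addvSl.
by rewrite -(vline_scale v (dj_neq0 _ bi0)) addvSr.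
Qed.

End PowersOfLinearPolynomials.

(** * The Wronskian is a perfect power *)

Theorem proposition5p19 (R : realType) (n k : nat)
    (U : {vspace {poly_(n.+1) (complex R)}}) :
  let l := (n.+1 - k)%N in
  (1 <= k <= n.+1)%N -> \dim U = k -> has_top_power_basis k U ->
  [/\ exists q : {poly_(k.+1) (complex R)}, Wronskian U %= (q : {poly _}) ^+ l,
      [|| npolyp n.+1 1 \notin U, k == 1 | l <= 1]%N ->
        Wronskian U %= Wronskian (derived_space l.-1 U) ^+ l
    & Wronskian U %= Wronskian (form_derived_space n l.-1 U) ^+ l].
Proof.
move=> l /andP[k_gt0 lekn] _ /top_power_basis_linpower_span[a [b [ab0 abD eU]]].
have char0 : [pchar (complex R)] =i pred0 by exact: pchar_num.
pose q := \prod_(i < k) linpoly (a i) (b i).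
have WU : Wronskian U %= q ^+ l by rewrite eU Wronskian_linpower_span.
have WV : (0 < l)%N ->
    Wronskian (linpower_span n.+1 (n - l.-1) a b) %= q.
  move=> l_gt0; have -> : (n - l.-1 = k)%N by move: l_gt0; rewrite /l; lia.
  (* Powers of degree k give the exponent k.+1 - k. *)
  by rewrite -[q]expr1 -(subSnn k) Wronskian_linpower_span // -subn_gt0.
have Wl V : ((0 < l)%N -> Wronskian V %= q) ->
    Wronskian U %= Wronskian (V : {vspace {poly_(n.+1) (complex R)}}) ^+ l.
  move=> eV; apply: (eqp_trans WU); rewrite eqp_sym.
  case: (posnP l) => [->|l_gt0]; first by rewrite !expr0 eqpxx.
  by rewrite eqp_exp // eV.
have le_l : (l.-1 <= n)%N by rewrite /l; lia.
split; last 1 first.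
- by apply: Wl => l_gt0; rewrite eU form_derived_linpower_span ?WV.
- exists (npolyp k.+1 q); rewrite npolypK //.
  apply: (leq_trans (size_poly_prod_leq _ _)).
  rewrite card_ord leq_subLR addnS ltnS addnn -muln2.
  rewrite -[in leqRHS](card_ord k) -sum_nat_const.
  by apply: leq_sum => i _; apply: size_linpoly.
move=> cond; apply: Wl => l_gt0.
case: (pickP (fun i => a i ^+ l.-1 == 0)) => [i | al0]; last first.
  by rewrite eU derived_linpower_span ?WV // => i; rewrite al0.
rewrite expf_eq0 => /andP[l1 /eqP ai0].
(* L_i is the nonzero constant b_i, so 1 is in U; moreover l >= 2.  Of the
   three cases of [cond], only k = 1 remains. *)
have bi0 : b i != 0 by move: (ab0 i); rewrite ai0 xpair_eqE eqxx.
have oneU : npolyp n.+1 1 \in U.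
  have -> : npolyp n.+1 1 = (b i ^- n) *: linpower n.+1 n (a i) (b i).
    apply/val_inj; rewrite /= linpowerE // npolypK ?size_poly1 //.
    rewrite ai0 /linpoly scale0r add0r -rmorphXn /= -mul_polyC -polyCM.
    by rewrite mulVf ?expf_neq0.
  by rewrite memvZ // eU memvE (sumv_sup i).
have k1 : k = 1%N.
  by case/or3P: cond => [|/eqP //|]; [rewrite oneU | case: (l) l1 => [|[]]].
have allI j : j = i.
  by apply: ord_inj; have [] := (ltn_ord j, ltn_ord i); lia.
have V0 : derived_space l.-1 U = 0%VS.
  rewrite eU /derived_space limg_sum big1 // => j _.
  rewrite (allI j) limg_line npoly_derivn_linpower // ai0 expr0n.
  rewrite eqn0Ngt l1 mul0rn scale0r.
  by apply/eqP; rewrite -subv0 -memvE mem0v.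
rewrite V0; apply: (eqp_trans (Wronskian0 _ _)).
rewrite /q (bigD1 i) //= big1 => [|j]; last by rewrite (allI j) eqxx.
rewrite mulr1 ai0 /linpoly scale0r add0r -alg_polyC eqp_sym.
exact: eqp_scale.
Qed.
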